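(* Consider $P^\star:=\min_{y\in\mathbb R^p}\{P(y):=f(y)+g(y)\}$ with $f,g:\mathbb R^p\to\mathbb R\cup\{+\infty\}$ proper, closed and convex, and let $y^\star$ be an optimal solution. Assume that $f$ is Lipschitz continuous with constant $L_f\in[0,+\infty)$, i.e. $|f(y)-f(\hat y)|\le L_f\|y-\hat y\|$ for all $y,\hat y\in\mathrm{dom}(f)$. (1) Let $\{y^k\}$ be generated by scheme (S1) of the context. Then, for all $k\ge1$, $$P(y^k)-P^\star\le\frac{\rho_0^2\|y^0-y^\star\|^2+4L_f^2+2L_f\rho_0\|y^0-y^\star\|}{2\rho_0k}.$$ (2) If $f$ is $L_f$-Lipschitz continuous on $\mathrm{dom}(f)$ and $g$ is $\mu_g$-strongly convex with $\mu_g>0$, and $\{y^k\}$ is generated by scheme (S2) of the context, then, for all $k\ge1$, $$P(y^k)-P^\star\le\frac{2\rho_0\|y^0-y^\star\|^2}{(k+1)^2}+\frac{8\big(L_f^2+L_f\rho_0\|y^0-y^\star\|\big)}{\rho_0(k+1)^2}.$$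
   Context: $\|\cdot\|$ is the Euclidean norm and $\mathrm{dom}(q)$ denotes the domain of a function $q$. For $\gamma>0$, $\mathrm{prox}_{\gamma q}(v):=\arg\min_u\{q(u)+\frac1{2\gamma}\|u-v\|^2\}$. $g$ is $\mu_g$-strongly convex if $g-\frac{\mu_g}2\|\cdot\|^2$ is convex. Standing assumption: the problem, rewritten as minimizing $f(x)+g(y)$ subject to $x-y=0$, has a saddle point of its Lagrangian $f(x)+g(y)-\langle x-y,\lambda\rangle$ (i.e. there exist $(x^\star,y^\star)\in\mathrm{dom}(f)\times\mathrm{dom}(g)$ and $\lambda^\star\in\mathbb R^p$ such that $(x^\star,y^\star)$ minimizes the Lagrangian at $\lambda=\lambda^\star$ and $x^\star=y^\star$), and $P^\star$ is finite and attained. Scheme (S1): choose $y^0\in\mathrm{dom}(g)$, $\rho_0>0$, set $\hat y^0:=y^0$, and for $k=0,1,2,\dots$, with $\rho_k:=\rho_0(k+1)$, $$y^{k+1}:=\mathrm{prox}_{g/\rho_k}\big(\mathrm{prox}_{f/\rho_k}(\hat y^k)\big),\qquad \hat y^{k+1}:=y^{k+1}+\tfrac{k}{k+2}(y^{k+1}-y^k).$$ Scheme (S2): choose $y^0\in\mathrm{dom}(g)$, $\rho_0\in(0,\frac{\mu_g}2]$, set $\tau_0:=1$, $\tilde y^0:=y^0$, and for $k=0,1,2,\dots$, with $\rho_k:=\rho_0/\tau_k^2$, $$\hat y^k:=(1-\tau_k)y^k+\tau_k\tilde y^k,\quad \tilde y^{k+1}:=\mathrm{prox}_{g/(\tau_k\rho_k)}\Big(\tfrac1{\tau_k}\mathrm{prox}_{f/\rho_k}(\hat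 y^k)-\tfrac{1-\tau_k}{\tau_k}y^k\Big),\quad y^{k+1}:=(1-\tau_k)y^k+\tau_k\tilde y^{k+1},$$ and $\tau_{k+1}:=\frac{\tau_k}2\big((\tau_k^2+4)^{1/2}-\tau_k\big)$.
   Formalization: Each bound is stated for those k ≥ 1 with y^k in dom(f): y^k may leave dom(f), making P(y^k)=+∞ and the printed bound false (f the indicator of [0,∞), g(y)=(y+1)²/2, y^0=0, where y^1<0). *)

(* Defs.v *)
From mathcomp Require Import all_boot all_order all_algebra.
From mathcomp Require Import all_classical all_reals all_analysis.

Set Implicit Arguments.
Unset Strict Implicit.
Unset Printing Implicit Defensive.

Import Order.TTheory GRing.Theory Num.Theory.
Import numFieldNormedType.Exports.

Local Open Scope classical_set_scope.
Local Open Scope ring_scope.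

(* The library norm on ['rV[R]_p] is the sup norm, hence the explicit Euclidean
   structure; both induce the same topology. *)
Definition dotv (R : realType) (p : nat) (u v : 'rV[R]_p) : R :=
  \sum_(i < p) u 0 i * v 0 i.

Definition enorm (R : realType) (p : nat) (u : 'rV[R]_p) : R :=
  Num.sqrt (dotv u u).

(* Functions R^p -> R \cup {+oo} are functions into [\bar R] that never take
   the value -oo; this is part of [properf]. *)
Definition edom (R : realType) (p : nat) (q : 'rV[R]_p -> \bar R) :
  set 'rV[R]_p := [set u | (q u < +oo)%E].

Definition properf (R : realType) (p : nat) (q : 'rV[R]_p -> \bar R) : Prop :=
  (forall u, (-oo < q u)%E) /\ edom q !=set0.

Definition closedf (R : realType) (p : nat) (q : 'rV[R]_p -> \bar R) : Prop :=
  closed [set z : 'rV[R]_p * R | (q z.1 <= z.2%:E)%E].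

Definition convexf (R : realType) (p : nat) (q : 'rV[R]_p -> \bar R) : Prop :=
  forall (u v : 'rV[R]_p) (t : R), 0 < t -> t < 1 ->
    (q (t *: u + (1 - t) *: v)%R <= t%:E * q u + (1 - t)%R%:E * q v)%E.

Definition strongly_convexf (R : realType) (p : nat) (mu : R)
    (q : 'rV[R]_p -> \bar R) : Prop :=
  convexf (fun u => (q u - (mu / 2 * enorm u ^+ 2)%:E)%E).

Definition lipschitz_dom (R : realType) (p : nat) (L : R)
    (q : 'rV[R]_p -> \bar R) : Prop :=
  forall u v, edom q u -> edom q v -> (`|q u - q v| <= (L * enorm (u - v))%:E)%E.

Definition argmin (R : realType) (p : nat) (q : 'rV[R]_p -> \bar R) :
  set 'rV[R]_p := [set u | forall w, (q u <= q w)%E].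

(* [prox gamma q v] is the set arg min, a singleton when [q] is proper, closed
   and convex and [0 < gamma]; [u = prox_(gamma q) v] is written
   [prox gamma q v u]. *)
Definition prox (R : realType) (p : nat) (gamma : R) (q : 'rV[R]_p -> \bar R)
    (v : 'rV[R]_p) : set 'rV[R]_p :=
  argmin (fun u => (q u + (1 / (2 * gamma) * enorm (u - v) ^+ 2)%:E)%E).

Definition objective (R : realType) (p : nat) (f g : 'rV[R]_p -> \bar R)
    (y : 'rV[R]_p) : \bar R := (f y + g y)%E.

Definition opt_value (R : realType) (p : nat) (f g : 'rV[R]_p -> \bar R) :
  \bar R := ereal_inf (range (objective f g)).

Definition lagrangian (R : realType) (p : nat) (f g : 'rV[R]_p -> \bar R)
    (x y lambda : 'rV[R]_p) : \bar R :=
  (f x + g y - (dotv (x - y) lambda)%:E)%E.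

Definition has_saddle_point (R : realType) (p : nat)
    (f g : 'rV[R]_p -> \bar R) : Prop :=
  exists xs ys lambda : 'rV[R]_p,
    [/\ edom f xs, edom g ys,
        forall x y, (lagrangian f g xs ys lambda <= lagrangian f g x y lambda)%E
      & xs = ys].

Definition rho1 (R : realType) (rho0 : R) (k : nat) : R := rho0 * k.+1%:R.

Definition scheme1 (R : realType) (p : nat) (f g : 'rV[R]_p -> \bar R)
    (rho0 : R) (y : nat -> 'rV[R]_p) : Prop :=
  exists yhat : nat -> 'rV[R]_p,
    [/\ edom g (y 0%N), yhat 0%N = y 0%N
      & forall k : nat,
          (exists2 x, prox (1 / rho1 rho0 k) f (yhat k) x
                    & prox (1 / rho1 rho0 k) g x (y k.+1)) /\
          yhat k.+1 = y k.+1 + (k%:R / k.+2%:R) *: (y k.+1 - y k)].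

Fixpoint tau (R : realType) (k : nat) : R :=
  if k is j.+1 then tau R j / 2 * (Num.sqrt (tau R j ^+ 2 + 4) - tau R j) else 1.

Definition rho2 (R : realType) (rho0 : R) (k : nat) : R := rho0 / tau R k ^+ 2.

Definition scheme2 (R : realType) (p : nat) (f g : 'rV[R]_p -> \bar R)
    (rho0 : R) (y : nat -> 'rV[R]_p) : Prop :=
  exists yhat ytilde : nat -> 'rV[R]_p,
    [/\ edom g (y 0%N), ytilde 0%N = y 0%N
      & forall k : nat, let t := tau R k in let r := rho2 rho0 k in
          [/\ yhat k = (1 - t) *: y k + t *: ytilde k,
              exists2 x, prox (1 / r) f (yhat k) x
                & prox (1 / (t * r)) g ((1 / t) *: x - ((1 - t) / t) *: y k)
                    (ytilde k.+1)
            & y k.+1 = (1 - t) *: y k + t *: ytilde k.+1]].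

(* Main.v *)
Require Import Defs.
From mathcomp Require Import all_boot all_order all_algebra.
From mathcomp Require Import all_classical all_reals all_analysis.
From mathcomp Require Import ring lra.

Set Implicit Arguments.
Unset Strict Implicit.

Import Order.TTheory GRing.Theory Num.Theory.
Import numFieldNormedType.Exports.

Local Open Scope classical_set_scope.
Local Open Scope ring_scope.

(** Both schemes are accelerated proximal-gradient methods in disguise.
    Replacing [f] by its Moreau envelope
    [f_r y = min_x (f x + r / 2 * enorm (x - y) ^+ 2)] gives a function with
    [r]-Lipschitz gradient [r *: (yhat - x')] at [yhat], where [x'] is the
    proximal point of [f] at [yhat]; the update of [y] by a proximal step on
    [g] is then an accelerated forward-backward step on [f_r + g].  The
    smoothing parameter [r] grows along the iterations, so [f_r] increases to
    [f].

    The argument keeps [x'] as an explicit variable and follows the penalised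
    gap [f x + g y - P + r / 2 * enorm (x - y) ^+ 2], where [P] is the optimal
    value.  One iteration contracts this gap by the factor [1 - t], up to a
    telescoping distance term, provided the incoming penalty is [(1 - t) * r]
    ([smoothed_gap_step]): this is the point where the growth of [r] is paid
    for by a completed square.  If [t] and [r] satisfy
    [(1 - t') * r' = r] and [r' ^+ 2 * t' ^+ 2 <= r * (r * t ^+ 2 + t * mu)],
    then multiplying the gaps by [r] makes them telescope, and the gap after
    step [k] is at most [r_0 ^+ 2 * D ^+ 2 / (2 * r_k)], where [D] is the
    distance from [y 0] to the solution.

    To come back to [f y + g y] the Lipschitz bound costs [L * a], with
    [a = enorm (x - y)]; the penalty [r / 2 * a ^+ 2] kept in the gap absorbs
    it up to [L ^+ 2 / (2 * r)].  Hence [smoothed_inertial_rate]: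
    the error is at most [(r_0 ^+ 2 * D ^+ 2 + L ^+ 2) / (2 * r_k)].

    The first scheme has [t_k = 1 / (k + 1)], [r_k = rho0 * (k + 1)] and
    [mu = 0]; the second has [t = tau] and [r_k = rho0 / tau_k ^+ 2], where
    [tau_k <= 2 / (k + 2)] and the strong convexity of [g] pays for the faster
    growth of [r].  Both bounds of the theorem are weaker than the common
    rate. *)

(** * Euclidean norm and strong convexity *)

Lemma enorm_sqr (R : realType) (p : nat) (u : 'rV[R]_p) :
  enorm u ^+ 2 = dotv u u.
Proof.
by rewrite sqr_sqrtr //; apply: sumr_ge0 => i _; rewrite -expr2 sqr_ge0.
Qed.

Lemma enorm_distC (R : realType) (p : nat) (u v : 'rV[R]_p) :
  enorm (u - v) = enorm (v - u).
Proof.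
by congr Num.sqrt; apply: eq_bigr => i _; rewrite !mxE; ring.
Qed.

Lemma fin_num_edom (R : realType) (p : nat) (q : 'rV[R]_p -> \bar R) u :
  properf q -> edom q u -> q u \is a fin_num.
Proof. by move=> [q_gt _] qu; rewrite fin_real // q_gt. Qed.

(** Lets convex functions share the statements made for a modulus [mu]. *)
Lemma convexf_strongly0 (R : realType) (p : nat) (q : 'rV[R]_p -> \bar R) :
  convexf q -> strongly_convexf 0 q.
Proof.
move=> q_cvx u v t t0 t1 /=; rewrite !mul0r !sube0; exact: q_cvx.
Qed.

(** Real-valued form of strong convexity.  The quadratic correction comes from
    the parallelogram-type identity for
    [enorm (t *: u + (1 - t) *: v) ^+ 2]; the closed range of [t] covers the
    inertial steps with parameter 1. *)
Lemma strongly_convex_fine (R : realType) (p : nat) (mu : R)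
    (q : 'rV[R]_p -> \bar R) (q_proper : properf q)
    (q_cvx : strongly_convexf mu q) (u v : 'rV[R]_p) (t : R) :
  edom q u -> edom q v -> 0 <= t <= 1 ->
  edom q (t *: u + (1 - t) *: v) /\
  fine (q (t *: u + (1 - t) *: v)) + mu / 2 * (t * (1 - t) * enorm (u - v) ^+ 2)
    <= t * fine (q u) + (1 - t) * fine (q v).
Proof.
move=> qu qv /andP[].
rewrite le_eqVlt => /predU1P[<- _|t0].
  by rewrite scale0r add0r subr0 scale1r; split=> //; lra.
rewrite le_eqVlt => /predU1P[->|t1].
  by rewrite subrr scale0r addr0 scale1r; split=> //; lra.
have := q_cvx u v t t0 t1.
have /fineK := fin_num_edom q_proper qu; set a := fine _ => <-.
have /fineK := fin_num_edom q_proper qv; set b := fine _ => <-.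
set w := t *: u + (1 - t) *: v.
have := q_proper.1 w; rewrite /edom /=.
case: (q w) => [c _||] //=.
rewrite -!EFinB -!EFinM -EFinD lee_fin ltry => H; split=> //.
suff E : enorm w ^+ 2 = t * enorm u ^+ 2 + (1 - t) * enorm v ^+ 2
                      - t * (1 - t) * enorm (u - v) ^+ 2.
  by rewrite E in H; lra.
rewrite !enorm_sqr /dotv !mulr_sumr -sumrN -!big_split /=.
by apply: eq_bigr => i _; rewrite !mxE; ring.
Qed.

(** Optimality condition of a proximal point, in the form
    [r *: (v - u)] is a (strong) subgradient of [q] at [u].  It is obtained
    without subdifferential calculus: compare [u] with the point at parameter
    [t] on the segment to [w], divide by [t] and let [t] tend to 0. *)
Lemma prox_fine (R : realType) (p : nat) (mu r : R)
    (q : 'rV[R]_p -> \bar R) (q_proper : properf q)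
    (q_cvx : strongly_convexf mu q) (u v : 'rV[R]_p) :
  0 < r -> prox (1 / r) q v u ->
  edom q u /\ forall w, edom q w ->
    fine (q u) + r * dotv (v - u) (w - u) + mu / 2 * enorm (w - u) ^+ 2
      <= fine (q w).
Proof.
move=> r0 u_min.
have coef : 1 / (2 * (1 / r)) = r / 2 by field; rewrite gt_eqF.
have qu : edom q u.
  have [_ [w qw]] := q_proper; have := u_min w.
  have := q_proper.1 u; rewrite /edom /=.
  have /fineK <- := fin_num_edom q_proper qw.
  by case: (q u) => [a _ _||] //=; rewrite ltry.
split=> // w qw.
set d := dotv (v - u) (w - u); set n := enorm (w - u) ^+ 2.
have n0 : 0 <= n by exact: sqr_ge0.
(* Minimality against a point of the segment, already divided by [t]. *)
have approx t : 0 < t -> t <= 1 ->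
    fine (q u) + r * d + mu / 2 * n <= fine (q w) + t * ((mu + r) / 2 * n).
  move=> t0 t1.
  have t01 : 0 <= t <= 1 by rewrite ltW.
  have [qz] := strongly_convex_fine q_proper q_cvx qw qu t01.
  set z := t *: w + _ in qz *; rewrite -/n.
  have := u_min z; rewrite coef.
  have /fineK := fin_num_edom q_proper qz; set c := fine _ => <-.
  have /fineK := fin_num_edom q_proper qu; set a := fine _ => <-.
  rewrite -!EFinD lee_fin.
  have -> : enorm (z - v) ^+ 2 = enorm (u - v) ^+ 2 - 2 * t * d + t ^+ 2 * n.
    rewrite /n !enorm_sqr /d /dotv !mulr_sumr -sumrN -!big_split /=.
    by apply: eq_bigr => i _; rewrite !mxE; ring.
  move=> H1 H2; rewrite -(ler_pM2l t0); lra.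
apply/ler_addgt0Pr => e e0.
set K := (mu + r) / 2 * n in approx.
have K0 : 0 < `|K| + e + 1 by have := normr_ge0 K; lra.
(* A step with [t * K <= e]; the summand [e] ensures [t <= 1]. *)
set t := e / (`|K| + e + 1).
have t0 : 0 < t by rewrite divr_gt0.
have t1 : t <= 1 by rewrite ler_pdivrMr // mul1r; have := normr_ge0 K; lra.
apply: le_trans (approx t t0 t1) _; rewrite lerD2l.
apply: le_trans (_ : t * `|K| <= _); first by rewrite ler_pM2l // ler_norm.
by rewrite mulrAC ler_pdivrMr // ler_pM2l //; lra.
Qed.

(** * The step sizes [tau] *)

(** The recurrence is best read through the ratio [r] of consecutive terms,
    the positive root of [r ^+ 2 + tau R k * r = 1]; this equation says
    [1 - tau R k.+1 = r ^+ 2]. *)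
Lemma tau_ratio (R : realType) (k : nat) : 0 < tau R k <= 1 ->
  exists r : R, [/\ tau R k.+1 = tau R k * r, 2^-1 <= r <= 1
                  & r ^+ 2 + tau R k * r = 1].
Proof.
set t := tau R k => /andP[t0 t1].
set s := Num.sqrt (t ^+ 2 + 4).
have s2 : s ^+ 2 = t ^+ 2 + 4 by rewrite sqr_sqrtr // addr_ge0 ?sqr_ge0.
have s_ge2 : 2 <= s.
  rewrite -(ler_pXn2r (n := 2)) ?nnegrE ?sqrtr_ge0 // s2.
  by have := sqr_ge0 t; lra.
have s_le : s <= t + 2 by nra.
exists ((s - t) / 2); split; [by rewrite /= -/t -/s; field | lra | nra].
Qed.

(** The equation of the ratio gives
    [1 / tau R k.+1 = 1 / tau R k + 1 / (1 + r)] with [r <= 1], so the inverses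
    grow by at least [1 / 2] at each step. *)
Lemma tau_bounds (R : realType) (k : nat) :
  0 < tau R k <= 1 /\ k.+2%:R * tau R k <= 2.
Proof.
elim: k => [|k [t01 IH]]; first by rewrite ltr01 lexx mulr1.
have [r [-> r01 rE]] := tau_ratio t01.
move: t01 IH r01 rE; set t := tau R k => t01 IH r01 rE.
rewrite -(natr1 k.+2).
have n0 : 0 <= k.+2%:R :> R by exact: ler0n.
by split; nra.
Qed.

(** * One accelerated step *)

(** What both schemes guarantee about the update of [y] from the proximal
    point [x] of [f].  The last condition is the subgradient inequality of [g]
    at [y'], tested at [(1 - t) *: y + t *: w], with the two values of [g] left
    separate and a gain from strong convexity measured at [z']. *)
Definition inertial_prox_step (R : realType) (p : nat) (g : 'rV[R]_p -> \bar R)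
    (mu t r : R) (x y y' z' : 'rV[R]_p) : Prop :=
  [/\ y' = (1 - t) *: y + t *: z', edom g y'
    & forall w, edom g w ->
      fine (g y') + r * t * dotv (x - y') (w - z')
        + t * mu / 2 * enorm (w - z') ^+ 2
      <= (1 - t) * fine (g y) + t * fine (g w)].

(** Here the proximal step produces [y'] itself, and [z'] is extrapolated: the
    optimality condition is averaged over the two test points [y] and [w]. *)
Lemma inertial_prox_step_prox (R : realType) (p : nat)
    (g : 'rV[R]_p -> \bar R) (g_proper : properf g) (g_convex : convexf g)
    (t r : R) (x y y' z' : 'rV[R]_p) :
  0 < t <= 1 -> 0 < r -> edom g y -> y' = (1 - t) *: y + t *: z' ->
  prox (1 / r) g x y' -> inertial_prox_step g 0 t r x y y' z'.
Proof.
move=> /andP[t0 t1] r0 gy y'E.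
move/(prox_fine g_proper (convexf_strongly0 g_convex) r0).
move=> [gy' H]; split=> // w gw.
have Hw := ler_wpM2l (ltW t0) (H w gw).
have t1' : 0 <= 1 - t by rewrite subr_ge0.
have Hy := ler_wpM2l t1' (H y gy).
have E : t * dotv (x - y') (w - z')
    = t * dotv (x - y') (w - y') + (1 - t) * dotv (x - y') (y - y').
  rewrite /dotv !mulr_sumr -!big_split /=.
  by apply: eq_bigr => i _; rewrite y'E !mxE; ring.
by rewrite -mulrA E; lra.
Qed.

(** Here the proximal step produces [z'], so strong convexity is available at
    [z'].  Its centre is chosen so that, after scaling by [t], its difference
    with [z'] becomes [x - y']; convexity then passes from [z'] to [y']. *)
Lemma inertial_prox_step_strong (R : realType) (p : nat)
    (g : 'rV[R]_p -> \bar R) (g_proper : properf g) (g_convex : convexf g)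
    (mu : R) (g_strong : strongly_convexf mu g)
    (t r : R) (x y y' z' : 'rV[R]_p) :
  0 < t <= 1 -> 0 < r -> edom g y -> y' = (1 - t) *: y + t *: z' ->
  prox (1 / (t * r)) g ((1 / t) *: x - ((1 - t) / t) *: y) z' ->
  inertial_prox_step g mu t r x y y' z'.
Proof.
move=> /andP[t0 t1] r0 gy y'E.
move/(prox_fine g_proper g_strong (mulr_gt0 t0 r0)).
move=> [gz' H].
have t01' : 0 <= 1 - t <= 1 by rewrite subr_ge0 t1 gerBl ltW.
have [gy' C] := strongly_convex_fine g_proper
                  (convexf_strongly0 g_convex) gy gz' t01'.
have tt : 1 - (1 - t) = t by ring.
rewrite tt -y'E in gy' C.
split=> // w gw.
have Hw := ler_wpM2l (ltW t0) (H w gw).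
set v := (1 / t) *: x - _ in Hw.
have E : t * dotv (v - z') (w - z') = dotv (x - y') (w - z').
  rewrite /dotv mulr_sumr; apply: eq_bigr => i _.
  by rewrite /v y'E !mxE; field; rewrite gt_eqF.
have E2 : t * (t * r * dotv (v - z') (w - z'))
   = r * t * dotv (x - y') (w - z') by rewrite -E; ring.
lra.
Qed.

(** Sum the optimality condition of [f], tested at [w] and [x] with weights [t]
    and [1 - t], and that of [g].  The scalar products combine into the squared
    distances to [w], the old and new penalties, and the square of
    [yhat - x' + (1 - t) *: (x - y)], which is discarded.  The old penalty
    appears with coefficient [(1 - t) ^+ 2 * r / 2], which dictates how fast
    the parameter may grow between two steps. *)
Lemma smoothed_gap_step (R : realType) (p : nat)
    (f g : 'rV[R]_p -> \bar R) (f_proper : properf f) (f_convex : convexf f)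
    (mu t r : R) (x y z yhat x' y' z' w : 'rV[R]_p) :
  0 < t <= 1 -> 0 < r -> edom f x -> edom f w -> edom g w ->
  yhat = (1 - t) *: y + t *: z ->
  prox (1 / r) f yhat x' -> inertial_prox_step g mu t r x' y y' z' ->
  let gap a b := fine (f a) + fine (g b) - (fine (f w) + fine (g w)) in
  gap x' y' + r / 2 * enorm (x' - y') ^+ 2
    + (r * t ^+ 2 + t * mu) / 2 * enorm (w - z') ^+ 2
  <= (1 - t) * (gap x y + (1 - t) * r / 2 * enorm (x - y) ^+ 2)
     + r * t ^+ 2 / 2 * enorm (w - z) ^+ 2.
Proof.
move=> /andP[t0 t1] r0 fx fw gw yhatE.
move/(prox_fine f_proper (convexf_strongly0 f_convex) r0).
move=> [fx' H] [y'E gy' G] /=.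
have {G}Hg := G w gw.
have Hw := ler_wpM2l (ltW t0) (H w fw).
have t1' : 0 <= 1 - t by rewrite subr_ge0.
have {H}Hx := ler_wpM2l t1' (H x fx).
set c := yhat - x' + (1 - t) *: (x - y).
have c0 := mulr_ge0 (ltW r0) (sqr_ge0 (enorm c)).
have E : t * dotv (yhat - x') (w - x') + (1 - t) * dotv (yhat - x') (x - x')
    + t * dotv (x' - y') (w - z')
  = 2^-1 * enorm (x' - y') ^+ 2 + t ^+ 2 / 2 * enorm (w - z') ^+ 2
    + 2^-1 * enorm c ^+ 2 - t ^+ 2 / 2 * enorm (w - z) ^+ 2
    - (1 - t) ^+ 2 / 2 * enorm (x - y) ^+ 2.
  rewrite !enorm_sqr /c /dotv !mulr_sumr -!sumrN -!big_split /=.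
  by apply: eq_bigr => i _; rewrite y'E yhatE !mxE; field.
have {}E := congr1 (fun a => r * a) E.
rewrite !mulrDr in E.
lra.
Qed.

(** * Convergence rate for growing penalties *)

(** The quantity [r k * gap + r k * (r k * t k ^+ 2 + t k * mu) / 2 * dist]
    is nonincreasing in [k]: the first condition on [t] and [r] matches both
    the weights and the penalties of consecutive gaps, the second compares the
    distance terms. *)
Theorem smoothed_inertial_rate (R : realType) (p : nat)
    (f g : 'rV[R]_p -> \bar R) (f_proper : properf f) (f_convex : convexf f)
    (L mu : R) (f_lip : lipschitz_dom L f)
    (t r : nat -> R) (y z yhat : nat -> 'rV[R]_p) (w : 'rV[R]_p) :
  edom f w -> edom g w -> t 0%N = 1 -> z 0%N = y 0%N -> edom g (y 0%N) ->
  (forall k, 0 < t k <= 1) -> (forall k, 0 < r k) ->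
  (forall k, (1 - t k.+1) * r k.+1 = r k) ->
  (forall k, r k.+1 ^+ 2 * t k.+1 ^+ 2 <= r k * (r k * t k ^+ 2 + t k * mu)) ->
  (forall k, yhat k = (1 - t k) *: y k + t k *: z k) ->
  (forall k, edom g (y k) -> exists2 x, prox (1 / r k) f (yhat k) x &
     inertial_prox_step g mu (t k) (r k) x (y k) (y k.+1) (z k.+1)) ->
  forall k, edom f (y k.+1) ->
    fine (f (y k.+1)) + fine (g (y k.+1)) - (fine (f w) + fine (g w))
    <= (r 0%N ^+ 2 * enorm (y 0%N - w) ^+ 2 + L ^+ 2) / (2 * r k).
Proof.
move=> fw gw t0 z0 gy0 t01 r_gt0 r_rec rt_rec yhatE step.
pose D := r 0%N ^+ 2 / 2 * enorm (w - y 0%N) ^+ 2.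
pose gap a b := fine (f a) + fine (g b) - (fine (f w) + fine (g w)).
have decay k : exists x, [/\ edom f x, edom g (y k.+1) &
    r k * (gap x (y k.+1) + r k / 2 * enorm (x - y k.+1) ^+ 2)
    + r k * (r k * t k ^+ 2 + t k * mu) / 2 * enorm (w - z k.+1) ^+ 2 <= D].
  elim: k => [|k [x [fx gy IH]]].
    have [x px gs] := step 0%N gy0.
    have [fx _] := prox_fine f_proper
                     (convexf_strongly0 f_convex) (r_gt0 0%N) px.
    exists x; split=> //; first by case: gs.
    (* With [t 0 = 1] the previous gap is weighted by 0, so [w] may stand for
       the missing previous proximal point of [f]. *)
    have := smoothed_gap_step f_proper f_convex (t01 0%N) (r_gt0 0%N) fw fw gw
              (yhatE 0%N) px gs.
    move/(ler_wpM2l (ltW (r_gt0 0%N))); rewrite /= -!/(gap _ _) t0 z0 /D.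
    lra.
  have [x' px gs] := step k.+1 gy.
  have [fx' _] := prox_fine f_proper
                   (convexf_strongly0 f_convex) (r_gt0 k.+1) px.
  exists x'; split=> //; first by case: gs.
  have := smoothed_gap_step f_proper f_convex (t01 k.+1) (r_gt0 k.+1) fx fw gw
            (yhatE k.+1) px gs.
  move/(ler_wpM2l (ltW (r_gt0 k.+1))); rewrite /= -!/(gap _ _) r_rec.
  rewrite [in leRHS]mulrDr (mulrA (r k.+1) (1 - t k.+1)).
  rewrite (mulrC (r k.+1) (1 - t k.+1)) r_rec.
  have := ler_wpM2r (sqr_ge0 (enorm (w - z k.+1))) (rt_rec k).
  lra.
move=> k fy.
have [x [fx gy H]] := decay k.
have rk := r_gt0 k.
have Hlip : fine (f (y k.+1)) - fine (f x) <= L * enorm (x - y k.+1).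
  have := f_lip _ _ fy fx.
  have /fineK <- := fin_num_edom f_proper fy.
  have /fineK <- := fin_num_edom f_proper fx.
  rewrite -EFinB abse_EFin lee_fin enorm_distC /=; apply: le_trans.
  exact: ler_norm.
set a := enorm (x - y k.+1) in H Hlip.
rewrite ler_pdivlMr ?mulr_gt0 //.
have n0 := sqr_ge0 (enorm (w - z k.+1)).
have c0 : 0 <= r k * (r k * t k ^+ 2 + t k * mu).
  exact: le_trans (mulr_ge0 (sqr_ge0 _) (sqr_ge0 _)) (rt_rec k).
have := mulr_ge0 c0 n0.
(* [L * a - r / 2 * a ^+ 2] is at most [L ^+ 2 / (2 * r)]. *)
have := sqr_ge0 (L - r k * a).
have := ler_wpM2l (ltW rk) Hlip.
move: H; rewrite /gap /D (enorm_distC _ w).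
move: (_ * _ + t k * mu) (enorm (w - z _) ^+ 2) => m n.
lra.
Qed.

(** * The two schemes *)

Lemma objective_gap (R : realType) (p : nat) (f g : 'rV[R]_p -> \bar R)
    (f_proper : properf f) (g_proper : properf g)
    (opt_fin : opt_value f g \is a fin_num) (w y : 'rV[R]_p) :
  argmin (objective f g) w -> edom f y -> edom g y ->
  [/\ edom f w, edom g w &
    (objective f g y - opt_value f g)%E =
    (fine (f y) + fine (g y) - (fine (f w) + fine (g w)))%:E].
Proof.
move=> w_min fy gy.
have E : opt_value f g = objective f g w.
  apply/eqP; rewrite eq_le; apply/andP; split.
    by apply: ereal_inf_lbound; exists w.
  by apply: le_ereal_inf_tmp => _ [v _ <-]; exact: w_min.
have := opt_fin; rewrite E /objective fin_numD => /andP[fw gw].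
split; first by rewrite /edom /= -(fineK fw) ltry.
  by rewrite /edom /= -(fineK gw) ltry.
rewrite -(fineK fw) -(fineK gw) -(fineK (fin_num_edom f_proper fy)).
by rewrite -(fineK (fin_num_edom g_proper gy)).
Qed.

Theorem corollary1 (R : realType) (p : nat) (f g : 'rV[R]_p -> \bar R)
    (f_proper : properf f) (f_closed : closedf f) (f_convex : convexf f)
    (g_proper : properf g) (g_closed : closedf g) (g_convex : convexf g)
    (saddle : has_saddle_point f g)
    (opt_fin : opt_value f g \is a fin_num)
    (ystar : 'rV[R]_p) (ystar_opt : argmin (objective f g) ystar)
    (Lf : R) (Lf_ge0 : 0 <= Lf) (f_lip : lipschitz_dom Lf f) :
  (forall (rho0 : R) (y : nat -> 'rV[R]_p),
     0 < rho0 -> scheme1 f g rho0 y ->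
     forall k : nat, (1 <= k)%N -> edom f (y k) ->
       (objective f g (y k) - opt_value f g <=
        ((rho0 ^+ 2 * enorm (y 0%N - ystar) ^+ 2 + 4 * Lf ^+ 2
          + 2 * Lf * rho0 * enorm (y 0%N - ystar)) / (2 * rho0 * k%:R))%:E)%E)
  /\
  (forall (mu_g rho0 : R) (y : nat -> 'rV[R]_p),
     0 < mu_g -> strongly_convexf mu_g g ->
     0 < rho0 -> rho0 <= mu_g / 2 -> scheme2 f g rho0 y ->
     forall k : nat, (1 <= k)%N -> edom f (y k) ->
       (objective f g (y k) - opt_value f g <=
        (2 * rho0 * enorm (y 0%N - ystar) ^+ 2 / k.+1%:R ^+ 2
         + 8 * (Lf ^+ 2 + Lf * rho0 * enorm (y 0%N - ystar))
           / (rho0 * k.+1%:R ^+ 2))%:E)%E).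
Proof.
set d := fun y : nat -> 'rV[R]_p => enorm (y 0%N - ystar).
have d_ge0 y : 0 <= d y by exact: sqrtr_ge0.
split.
  move=> rho0 y rho0_gt0 [yhat [gy0 yhat0 step]] [//|k] _ fyk.
  pose t (j : nat) : R := j.+1%:R^-1.
  have t01 j : 0 < t j <= 1.
    by rewrite invr_gt0 ltr0n invf_le1 ?ltr0n // ler1n.
  have r_gt0 j : 0 < rho1 rho0 j by rewrite mulr_gt0.
  have gy j : edom g (y j).
    case: j => // j; have [[x _ py] _] := step j.
    by have [] := prox_fine g_proper (convexf_strongly0 g_convex) (r_gt0 j) py.
  have [fw gw ->] :=
    objective_gap f_proper g_proper opt_fin ystar_opt fyk (gy k.+1).
  (* The auxiliary sequence that the first scheme hides: [z j.+1] extends the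
     step from [y j] to [y j.+1] by the factor [1 / t j = j + 1]. *)
  pose z (j : nat) := y j + j.-1%:R *: (y j - y j.-1).
  have yhatE j : yhat j = (1 - t j) *: y j + t j *: z j.
    case: j => [|j].
      by rewrite yhat0 /t /z invr1 subrr scale0r add0r scale1r scale0r addr0.
    have [_ ->] := step j; apply/rowP => i; rewrite !mxE /= /t.
    by field; rewrite -natrD pnatr_eq0.
  have yE j : y j.+1 = (1 - t j) *: y j + t j *: z j.+1.
    apply/rowP => i; rewrite !mxE /= /t -natr1.
    by field; rewrite ?nat1r ?natr1 pnatr_eq0.
  rewrite lee_fin.
  have := smoothed_inertial_rate f_proper f_convex (mu := 0) f_lip (t := t)
    (r := rho1 rho0) (y := y) (z := z) (yhat := yhat) fw gw _ _ gy0 t01 r_gt0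
    _ _ yhatE _ fyk.
  rewrite -/(d y) => H.
  apply: le_trans (H _ _ _ _ _) _; rewrite /rho1.
  - by rewrite /t invr1.
  - by rewrite /z scale0r addr0.
  - by move=> j; rewrite /t -natr1; field; rewrite ?nat1r ?natr1 pnatr_eq0.
  - move=> j; rewrite mulr0 addr0 /t mulrA -expr2 -!exprMn.
    by rewrite !mulfK ?pnatr_eq0.
  - move=> j gyj; have [[x px py] _] := step j; exists x => //.
    exact: (inertial_prox_step_prox g_proper g_convex (t01 j) (r_gt0 j)
             (gy j)).
  rewrite mulr1 mulrA ler_pM2r ?invr_gt0 ?mulr_gt0 //.
  have := sqr_ge0 Lf.
  have := mulr_ge0 (mulr_ge0 Lf_ge0 (ltW rho0_gt0)) (d_ge0 y).
  rewrite /d; lra.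
move=> mu rho0 y mu_gt0 g_strong rho0_gt0 rho0_le [yhat [z [gy0 z0 step]]].
move=> [//|k] _ fyk.
have t01 j : 0 < tau R j <= 1 by case: (tau_bounds R j).
have t_gt0 j : 0 < tau R j by case/andP: (t01 j).
have r_gt0 j : 0 < rho2 rho0 j by rewrite divr_gt0 // exprn_gt0.
have gstep j : edom g (y j) -> exists2 x, prox (1 / rho2 rho0 j) f (yhat j) x &
    inertial_prox_step g mu (tau R j) (rho2 rho0 j) x (y j) (y j.+1) (z j.+1).
  move=> gyj; have [_ [x px pz] yE] := step j; exists x => //.
  exact: inertial_prox_step_strong.
have gy j : edom g (y j).
  by elim: j => // j /gstep[x _ []].
have [fw gw ->] :=
  objective_gap f_proper g_proper opt_fin ystar_opt fyk (gy k.+1).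
have yhatE j : yhat j = (1 - tau R j) *: y j + tau R j *: z j.
  by have [] := step j.
rewrite lee_fin.
have := smoothed_inertial_rate f_proper f_convex (mu := mu) f_lip (t := tau R)
  (r := rho2 rho0) (y := y) (z := z) (yhat := yhat) fw gw erefl z0 gy0 t01 r_gt0
  _ _ yhatE gstep fyk.
rewrite -/(d y) => H.
apply: le_trans (H _ _) _; rewrite /rho2.
- move=> j; have [q [-> /andP[q2 _] qE]] := tau_ratio (t01 j).
  have -> : 1 - tau R j * q = q ^+ 2 by lra.
  by field; rewrite !gt_eqF //; lra.
- move=> j; have [q [-> /andP[q2 _] qE]] := tau_ratio (t01 j).
  have tj := t_gt0 j; have q0 : 0 < q by lra.
  set s := tau R j in qE tj *.
  have -> : (rho0 / (s * q) ^+ 2) ^+ 2 * (s * q) ^+ 2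
     = (rho0 / s ^+ 2) * (rho0 / q ^+ 2) by field; rewrite !gt_eqF.
  rewrite ler_pM2l ?divr_gt0 ?exprn_gt0 // ler_pdivrMr ?exprn_gt0 //.
  have -> : rho0 / s ^+ 2 * s ^+ 2 = rho0 by field; rewrite gt_eqF.
  (* Combine [rho0 <= mu / 2] with [2^-1 <= q]. *)
  have rq : rho0 <= q * mu by nra.
  have := ler_wpM2l (ltW (mulr_gt0 tj q0)) rq.
  have : rho0 * (1 - q ^+ 2) = s * q * rho0 by rewrite -qE; ring.
  lra.
have [_ tk] := tau_bounds R k.
have tk0 := t_gt0 k; set s := tau R k in tk tk0 *.
set n : R := k.+2%:R in tk *.
have n0 : 0 < n by rewrite ltr0n.
rewrite expr1n divr1.
set a := d y; have a0 : 0 <= a := d_ge0 y.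
have -> : (rho0 ^+ 2 * a ^+ 2 + Lf ^+ 2) / (2 * (rho0 / s ^+ 2))
  = (rho0 ^+ 2 * a ^+ 2 + Lf ^+ 2) / (2 * rho0 * n ^+ 2) * (n * s) ^+ 2.
  by field; rewrite !gt_eqF.
apply: le_trans
  (_ : (rho0 ^+ 2 * a ^+ 2 + Lf ^+ 2) / (2 * rho0 * n ^+ 2) * 2 ^+ 2 <= _).
  apply: ler_wpM2l; last by rewrite ler_pXn2r // nnegrE ?mulr_ge0 // ltW.
  by rewrite divr_ge0 ?addr_ge0 ?mulr_ge0 ?sqr_ge0 // ltW.
rewrite -subr_ge0.
rewrite (_ : _ - _ = (6 * Lf ^+ 2 + 8 * (Lf * rho0 * a)) / (rho0 * n ^+ 2)).
  apply: divr_ge0; last by rewrite mulr_ge0 ?sqr_ge0 // ltW.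
  by rewrite addr_ge0 ?mulr_ge0 ?sqr_ge0 // ltW.
by rewrite /a /d; field; rewrite !gt_eqF.
Qed.
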